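(* Let $s\ge 1$ be a fixed integer. Consider a sequence of $(s+1)$-tuples of integers $2\le n_0\le n_1\le\dots\le n_s$ (indexed so that $n_s\to\infty$) such that $n_0=(\log n_s)^{\alpha}$ with $\alpha\ge 2\sqrt{\frac{\log n_s}{\log\log n_s}}$. For every $0\le i\le s-1$ let $k_i=\frac{\log n_s}{\log n_i}$, and let $x_0$ be the unique root of the equation $sx-1-\sum_{j=0}^{s-1}x^{\frac{k_j-1}{k_j}}=0$ in the interval $[1,\infty)$. Then $$ch(K_{n_0,\dots,n_s})=(1+o(1))\frac{\log n_s}{\log x_0}$$ as $n_s\to\infty$.
   Context: All logarithms are to base 2. For a graph $G=(V,E)$, the choice number $ch(G)$ is the minimum integer $k$ such that for every assignment of a list $S(v)$ of at least $k$ colors to each vertex $v\in V$, there is a proper vertex coloring of $G$ assigning to each vertex $v$ a color from $S(v)$. $K_{n_0,\dots,n_s}$ denotes the complete $(s+1)$-partite graph with parts of sizes $n_0,\dots,n_s$. *)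

(* Defs.v *)
From mathcomp Require Import all_boot.
From Stdlib Require Import Reals ClassicalDescription.

Set Implicit Arguments.
Unset Strict Implicit.
Unset Printing Implicit Defensive.

Definition log2 (x : R) : R := (ln x / ln 2)%R.

Definition choosable (V : finType) (adj : rel V) (k : nat) : Prop :=
  forall S : V -> seq nat,
    (forall v, k <= size (undup (S v))) ->
    exists f : V -> nat,
      (forall v, f v \in S v) /\ (forall u v, adj u v -> f u != f v).

Definition choosableb (V : finType) (adj : rel V) (k : nat) : bool :=
  if excluded_middle_informative (choosable adj k) then true else false.

(* Choice number: the minimum k such that G is k-choosable
   (such a k always exists; the junk value 0 is never used). *)
Definition ch (V : finType) (adj : rel V) : nat :=
  match excluded_middle_informative (exists k, choosableb adj k) with
  | left h => ex_minn h
  | right _ => 0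
  end.

Definition Kverts (s : nat) (n : 'I_s.+1 -> nat) : finType :=
  {i : 'I_s.+1 & 'I_(n i)}.

Definition Kadj (s : nat) (n : 'I_s.+1 -> nat) : rel (Kverts n) :=
  fun u v => tag u != tag v.

Definition chK (s : nat) (n : 'I_s.+1 -> nat) : nat := ch (@Kadj s n).

(* Main.v *)
(* Put T = log n_s / log x_0 and u_j = n_j^(-1/T).  Dividing the equation of x_0
   by x_0 turns it into u_0 + ... + u_s = s, so the numbers p_j = 1 - u_j are a
   probability distribution on the parts.

   Upper bound: assign every color independently to part j with probability
   p_j.  A vertex of part j whose list has k >= (1 + d) T colors gets no usable
   color with probability u_j^k <= n_j^(-1-d), and these failure probabilities
   add up to less than 1.

   Lower bound: let k <= (1 - d) T and take a palette of t ~ 2 T^2 (T + 1) colors.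
   A color set of size at most p_j t misses a random k-subset of the palette with
   probability at least (u_j - k/t)^k >= n_j^(d-1) / 2, so that n_j greedily
   chosen k-subsets suffice to leave no such set meeting all of them; these are
   the lists in part j.  As the p_j add up to 1, every coloring uses at most p_j t
   colors on some part j. *)
From Stdlib Require Import ZArith Reals Lra ClassicalDescription.
From Coquelicot Require Import Rcomplements.
Require Import Defs.
From mathcomp Require Import all_boot all_order all_algebra Rstruct.

Set Implicit Arguments.
Unset Strict Implicit.
Unset Printing Implicit Defensive.

Import Order.TTheory GRing.Theory Num.Theory.

(** * Averaging arguments and combinatorial criteria for choosability *)

Section Combinatorics.
Local Open Scope ring_scope.
Variable F : realFieldType.

Lemma exists_ge_average (T : finType) (X : {set T}) (f : T -> F) (c : F) :
  (0 < #|X|)%N -> c * #|X|%:R <= \sum_(y in X) f y ->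
  exists2 y, y \in X & c <= f y.
Proof.
move=> /card_gt0P [y0 y0X] h.
case: (boolP [exists y in X, c <= f y]) => [/exists_inP // | /exists_inPn lt].
suff : \sum_(y in X) f y < c * #|X|%:R by rewrite ltNge h.
rewrite mulr_natr -sumr_const; apply: ltr_sum => [|y yX]; last first.
  by rewrite ltNge lt.
by apply/hasP; exists y0; rewrite ?mem_index_enum.
Qed.

Lemma exists_le_weighted_average (I : finType) (p h : I -> F) :
  (forall i, 0 <= p i) -> \sum_i p i = 1 ->
  exists i, h i <= \sum_j p j * h j.
Proof.
move=> p_ge0 sp; set a := \sum_j _.
case: (boolP [exists i, h i <= a]) => [/existsP // | /existsPn gt].
have : 0 <= \sum_j p j * (a - h j).
  under eq_bigr do rewrite mulrBr.
  by rewrite sumrB -mulr_suml sp mul1r subrr.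
have le0 j : p j * (a - h j) <= 0.
  by apply: mulr_ge0_le0 => //; rewrite subr_le0 ltW // ltNge gt.
move=> ge0.
have [i pi] : exists i, p i != 0.
  apply/existsP; apply: contraT => /existsPn p0.
  have: \sum_i p i = 0 by apply: big1 => i _; apply/eqP; have := p0 i; rewrite negbK.
  by move/eqP; rewrite sp oner_eq0.
suff : \sum_j p j * (a - h j) < 0 by rewrite ltNge ge0.
rewrite (bigD1 i) //= -[X in _ < X]addr0; apply: ltr_leD.
  by rewrite nmulr_llt0 ?lt0r ?pi ?p_ge0 // subr_lt0 ltNge gt.
by apply: sumr_le0 => j _.
Qed.

(* Expectation of a sum of products under independent choices of the
   [f c], with law [p]; conditional expectations are taken one [c] at a time. *)
Lemma exists_le_independent_expectation (V C I : finType) (p : I -> F)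
    (G : V -> nat -> I -> F) (cs : seq nat) (w : V -> F) :
  (forall i, 0 <= p i) -> \sum_i p i = 1 -> uniq cs ->
  exists f : nat -> I,
    \sum_v w v * \prod_(c <- cs) G v c (f c)
    <= \sum_v w v * \prod_(c <- cs) \sum_i p i * G v c i.
Proof.
move=> p0 p1; elim: cs w => [|c cs IH] w.
  (* Only an element of [I] is wanted here: it exists because the probabilities add up to 1. *)
  have [i _] := exists_le_weighted_average (fun=> 0) p0 p1.
  by move=> _; exists (fun=> i); under eq_bigr do rewrite big_nil;
     under [leRHS]eq_bigr do rewrite big_nil.
move=> /= /andP[cNcs ucs].
pose h i := \sum_v (w v * G v c i) * \prod_(d <- cs) \sum_j p j * G v d j.
have [i hi] := exists_le_weighted_average h p0 p1.
(* The factor of the color just fixed moves into the weight, hence the induction over all [w]. As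
   [cs] has no repetition, setting [f] at [c] leaves the other factors alone. *)
have [f Hf] := IH (fun v => w v * G v c i) ucs.
exists (fun d => if d == c then i else f d).
apply: (@le_trans _ _ (h i)).
  apply: le_trans Hf; apply: ler_sum => v _.
  rewrite big_cons eqxx mulrA le_eqVlt; apply/orP; left; apply/eqP.
  congr (_ * _); rewrite !big_seq; apply: eq_bigr => d dcs.
  by case: eqP => // dc; rewrite -dc dcs in cNcs.
apply: le_trans hi _; rewrite /h /=.
under eq_bigr do rewrite mulr_sumr.
rewrite exchange_big /= le_eqVlt; apply/orP; left; apply/eqP.
apply: eq_bigr => v _; rewrite big_cons mulrA mulr_sumr mulr_suml.
apply: eq_bigr => j _; rewrite !mulrA; congr (_ * _ * _).
by rewrite mulrC.
Qed.

(** Part [i] may use exactly the colors that [f] sends to [i], so different parts share no color. A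
    vertex fails when no color of its list goes to its part; the expected number of failures is
    below 1, so some [f] has none. *)
Lemma choosable_of_weights (s : nat) (n : 'I_s.+1 -> nat) (p : 'I_s.+1 -> F) k :
  (forall i, 0 <= p i) -> \sum_i p i = 1 ->
  \sum_i (n i)%:R * (1 - p i) ^+ k < 1 ->
  choosable (@Kadj s n) k.
Proof.
move=> p0 p1 lt1 S HS.
have ple1 i : p i <= 1.
  by rewrite -p1 (bigD1 i) //= lerDl sumr_ge0.
pose cs := undup (flatten [seq S v | v : Kverts n]).
(* The product of [G v c (f c)] over [cs] is the indicator that [v] fails under [f]. *)
pose G (v : Kverts n) c i : F := if (c \in S v) && (i == tag v) then 0 else 1.
have [f Hf] := @exists_le_independent_expectation (Kverts n) 'I_1 'I_s.+1 p G cs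
  (fun=> 1) p0 p1 (undup_uniq _).
have EG v c : \sum_i p i * G v c i = if c \in S v then 1 - p (tag v) else 1.
  rewrite /G; case: (c \in S v) => /=; last first.
    by rewrite -[RHS]p1; apply: eq_bigr => i _; rewrite mulr1.
  rewrite -[X in _ = X - _]p1 (bigD1 (tag v)) //= [in RHS](bigD1 (tag v)) //=.
  rewrite eqxx mulr0 add0r addrAC subrr add0r; apply: eq_bigr => i /negbTE ->; by rewrite mulr1.
have EP v : \prod_(c <- cs) \sum_i p i * G v c i <= (1 - p (tag v)) ^+ k.
  under eq_bigr do rewrite EG.
  rewrite -big_mkcond /= big_const_seq iter_mulr_1.
  apply: ler_wiXn2l; [by rewrite subr_ge0 | by rewrite gerBl |].
  apply: leq_trans (HS v) _; rewrite -size_filter.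
  apply: uniq_leq_size; first exact: undup_uniq.
  move=> c; rewrite mem_undup mem_filter => cS; rewrite cS /= mem_undup.
  by apply/flattenP; exists (S v) => //; apply: map_f; rewrite mem_enum.
have sum_lt1 : \sum_v 1 * \prod_(c <- cs) G v c (f c) < 1.
  apply: le_lt_trans Hf _; apply: le_lt_trans lt1.
  apply: (@le_trans _ _ (\sum_(v : Kverts n) (1 - p (tag v)) ^+ k)).
    by apply: ler_sum => v _; rewrite mul1r.
  rewrite -(@sig_big_dep _ _ _ 'I_s.+1 (fun i => 'I_(n i)) xpredT (fun=> xpredT)
     (fun i _ => (1 - p i) ^+ k)) /=.
  by apply: ler_sum => i _; rewrite sumr_const card_ord mulr_natl.
have G01 v c i : 0 <= G v c i by rewrite /G; case: ifP.
have ok v : exists c, (c \in S v) && (f c == tag v).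
  suff /hasP[c _ h] : has (fun c => (c \in S v) && (f c == tag v)) cs by exists c.
  apply: contraT => /hasPn none.
  have E1 : \prod_(c <- cs) G v c (f c) = 1.
    rewrite big_seq big1 // => c /none; by rewrite /G => /negbTE ->.
  suff : (1 : F) < 1 by rewrite ltxx.
  apply: le_lt_trans sum_lt1; rewrite (bigD1 v) //= E1 mulr1 lerDl.
  by apply: sumr_ge0 => u _; rewrite mul1r prodr_ge0.
exists (fun v => xchoose (ok v)); split.
  by move=> v; case/andP: (xchooseP (ok v)).
move=> u v; apply: contraNneq => E.
case/andP: (xchooseP (ok u)) => _ /eqP <-.
by case/andP: (xchooseP (ok v)) => _ /eqP <-; rewrite E.
Qed.

(* Greedily, some [y] kills an average share of the surviving [z]. *)
Lemma greedy_cover (Y Z : finType) (X : {set Y}) (P : {set Z})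
    (kill : Y -> Z -> bool) (q : F) (m : nat) :
  (0 < #|X|)%N -> q <= 1 ->
  (forall z, z \in P -> q * #|X|%:R <= #|[set y in X | kill y z]|%:R) ->
  exists g : seq Y, [/\ size g = m, all (mem X) g &
    #|[set z in P | ~~ has (kill^~ z) g]|%:R <= (1 - q) ^+ m * #|P|%:R].
Proof.
move=> X0 q1 H; elim: m => [|m [g [sg gX Hg]]].
  exists [::]; split => //; rewrite mul1r ler_nat.
  by apply: subset_leq_card; apply/subsetP => z; rewrite inE => /andP[].
set Q := [set z in P | _] in Hg.
have [y yX Hy] : exists2 y, y \in X & q * #|Q|%:R <= #|[set z in Q | kill y z]|%:R.
  apply: exists_ge_average => //.
  have E (y : Y) : #|[set z in Q | kill y z]|%:R = \sum_(z in Q) (kill y z)%:R :> F.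
    rewrite cardsE -sum1_card natr_sum [LHS]big_mkcondr /=.
    by apply: eq_bigr => z _; case: (kill y z).
  under eq_bigr do rewrite E.
  (* Double counting of the pairs with [kill y z]: each surviving [z] is killed by at least a share
     [q] of [X]. *)
  rewrite exchange_big /= mulrAC mulr_natr -sumr_const; apply: ler_sum => z.
  rewrite inE => /andP[zP _]; apply: le_trans (H z zP) _.
  rewrite cardsE -sum1_card natr_sum [leLHS]big_mkcondr /=.
  by apply: ler_sum => y _; case: (kill y z).
exists (y :: g); split => /=; [by rewrite sg | by rewrite yX |].
rewrite exprS -mulrA.
apply: le_trans (ler_wpM2l _ Hg); last by rewrite subr_ge0.
have -> : [set z in P | ~~ (kill y z || has (kill^~ z) g)] = Q :\: [set z in Q | kill y z].
  apply/setP => z; rewrite !inE negb_or.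
  by case: (z \in P); case: (has _ g); case: (kill y z).
rewrite mulrBl mul1r lerBrDr -[in leRHS](cardsID [set z in Q | kill y z] Q).
rewrite addnC natrD lerD2l (setIidPr _) //.
by apply/subsetP => z; rewrite inE => /andP[].
Qed.

(** [q i] bounds from below the share of k-subsets of a palette of t colors that miss a given set of
    at most p_i t colors. After n_i greedy choices, fewer than one of the at most 2^t such sets
    still meets all chosen subsets. *)
Lemma not_choosable_of_weights (s : nat) (n : 'I_s.+1 -> nat) (p q : 'I_s.+1 -> F) t k :
  (k <= t)%N -> 1 <= \sum_i p i -> (forall i, q i <= 1) ->
  (forall i a, a%:R <= p i * t%:R -> (a <= t)%N ->
     q i * 'C(t, k)%:R <= 'C(t - a, k)%:R) ->
  (forall i, (1 - q i) ^+ n i * 2 ^+ t < 1) ->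
  ~ choosable (@Kadj s n) k.
Proof.
move=> kt sp q1 Hq Hlt.
pose X := [set B : {set 'I_t} | (B \subset [set: 'I_t]) && (#|B| == k)].
have cX : #|X| = 'C(t, k) by rewrite cards_draws cardsT card_ord.
have lists i : exists g : seq {set 'I_t}, [/\ size g = n i, all (mem X) g &
   forall A : {set 'I_t}, #|A|%:R <= p i * t%:R ->
     has (fun B : {set 'I_t} => [disjoint B & A]) g].
  pose P := [set A : {set 'I_t} | #|A|%:R <= p i * t%:R].
  have [||A|g [sg gX]] := @greedy_cover _ _ X P
    (fun B A : {set 'I_t} => [disjoint B & A]) (q i) (n i).
  - by rewrite cX bin_gt0.
  - exact: q1.
  - rewrite inE cX => HA; apply: le_trans (Hq i #|A| HA _) _.
      by rewrite -[X in (_ <= X)%N](card_ord t) max_card.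
    rewrite ler_nat; have -> : (t - #|A| = #|~: A|)%N by rewrite [RHS]cardsCs setCK card_ord.
    rewrite -cards_draws; apply: subset_leq_card; apply/subsetP => B.
    by rewrite !inE subsetT /= => /andP[BA ->]; rewrite disjoints_subset BA.
  move=> lt; exists g; split => // A HA; apply: contraT => none.
  have : #|[set z in P | ~~ has (fun B : {set 'I_t} => [disjoint B & z]) g]|%:R
           < 1 :> F.
    apply: le_lt_trans lt _; apply: le_lt_trans (Hlt i).
    apply: ler_wpM2l; first by rewrite exprn_ge0 // subr_ge0.
    rewrite -natrX ler_nat -[X in (2 ^ X)%N](card_ord t) -cardsT -card_powerset.
    by apply: subset_leq_card; apply/subsetP => B _; rewrite inE subsetT.
  rewrite ltrn1 ltnS leqn0 cards_eq0 => /eqP/setP/(_ A); by rewrite !inE HA none.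
have [g Hg] := fin_all_exists lists.
(* The j-th vertex of part i gets the j-th chosen subset as its list. *)
pose S (v : Kverts n) : seq nat := map val (enum (nth set0 (g (tag v)) (tagged v))).
move=> /(_ S) [v|f [fS fE]].
  rewrite undup_id ?map_inj_uniq ?enum_uniq //; last exact: val_inj.
  rewrite size_map -cardE; have [sg /allP gX _] := Hg (tag v).
  have /gX : nth set0 (g (tag v)) (tagged v) \in g (tag v) by rewrite mem_nth // sg.
  by rewrite !inE subsetT => /eqP ->.
pose A i : {set 'I_t} := [set c : 'I_t | [exists v : Kverts n, (tag v == i) && (f v == c)]].
have disj : \sum_i #|A i|%:R <= t%:R :> F.
  rewrite -natr_sum ler_nat -[X in (_ <= X)%N](card_ord t) -cardsT.
  rewrite -sum1_card.
  under eq_bigr do rewrite -sum1_card big_mkcond.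
  rewrite exchange_big /=; under [X in (_ <= X)%N]eq_bigl do rewrite inE.
  apply: leq_sum => c _.
  case: (boolP [exists i, c \in A i]) => [/existsP [i ci]|/existsPn none]; last first.
    by rewrite big1 // => i _; rewrite (negbTE (none i)).
  rewrite (bigD1 i) //= ci big1 // => j ji.
  case: ifP => // cj; exfalso.
  move: ci cj; rewrite !inE => /existsP[u /andP[/eqP ui /eqP uc]].
  move=> /existsP[v /andP[/eqP vj /eqP vc]].
  have /fE : Kadj u v by rewrite /Kadj ui vj eq_sym.
  by rewrite uc vc eqxx.
(* The color sets [A i] of the parts are disjoint and the quotas p_i t add up to at least t, so some
   part stays within its quota. One of its lists then misses [A i], although the vertex with that
   list takes its color from it. *)
case: (boolP [exists i, #|A i|%:R <= p i * t%:R]) => [/existsP [i Ai]|/existsPn none].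
  have [sg _ /(_ _ Ai) /(has_nthP set0)[j]] := Hg i.
  rewrite sg => jn; set v : Kverts n := Tagged (fun i => 'I_(n i)) (Ordinal jn).
  have /mapP[c] := fS v; rewrite mem_enum /= => cB fvc.
  have cA : c \in A i by rewrite inE; apply/existsP; exists v; rewrite fvc !eqxx.
  by move=> /pred0P /(_ c) /=; rewrite cB cA.
have : \sum_i p i * t%:R < \sum_i #|A i|%:R.
  apply: ltr_sum => [|i _]; last by rewrite ltNge none.
  by apply/hasP; exists ord0; rewrite ?mem_index_enum.
rewrite ltNge -mulr_suml; case/negP; apply: le_trans disj _.
by rewrite ler_peMl.
Qed.
(** After multiplication by k! these are falling factorials: that of t is at most t^k, that of t - a
    at least (t - a - k)^k, and x t <= t - a - k. *)
Lemma binomial_ratio_ge (t a k : nat) (x : F) :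
  0 <= x -> x * t%:R + k%:R + a%:R <= t%:R ->
  x ^+ k * 'C(t, k)%:R <= 'C(t - a, k)%:R.
Proof.
move=> x0 h.
have fle : (t ^_ k <= t ^ k)%N.
  rewrite ffact_prod -[X in (_ <= _ ^ X)%N]card_ord -prod_nat_const.
  by apply: leq_prod => i _; apply: leq_subr.
have fge m : ((m - k) ^ k <= m ^_ k)%N.
  rewrite ffact_prod -[X in (_ ^ X <= _)%N]card_ord -prod_nat_const.
  by apply: leq_prod => i _; apply: leq_sub2l; apply: ltnW.
have kat : (k + a <= t)%N.
  by rewrite -(ler_nat F) natrD; apply: le_trans h; rewrite -addrA lerDr mulr_ge0.
rewrite -(ler_pM2r (x := (k`!)%:R)) ?ltr0n ?fact_gt0 // -mulrA -!natrM !bin_ffact.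
apply: (@le_trans _ _ (x ^+ k * (t ^ k)%:R)).
  by rewrite ler_wpM2l ?exprn_ge0 // ler_nat.
apply: (@le_trans _ _ ((t - a - k) ^ k)%:R); last by rewrite ler_nat.
rewrite !natrX -exprMn; apply: lerXn2r; rewrite ?nnegrE ?mulr_ge0 //.
rewrite -subnDA addnC natrB //  natrD opprD addrA.
by rewrite !lerBrDr addrAC.
Qed.
End Combinatorics.

(** * Elementary real inequalities *)

Local Open Scope R_scope.

Lemma exp_nondecreasing (x y : R) : x <= y -> exp x <= exp y.
Proof. by case=> [lt|->]; [left; apply: exp_increasing | right]. Qed.

Lemma floor_nat (x : R) : 0 <= x -> exists k : nat, INR k <= x < INR k + 1.
Proof.
move=> x0; have [h1 h2] := base_Int_part x.
have ge0 : Z.le Z0 (Int_part x).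
  apply/Z.lt_succ_r; apply: lt_IZR; rewrite succ_IZR; lra.
exists (Z.to_nat (Int_part x)).
by rewrite INR_IZR_INZ Z2Nat.id //; lra.
Qed.

Lemma bernoulli_le (x : R) (k : nat) : 0 <= x <= 1 -> 1 - INR k * x <= (1 - x) ^ k.
Proof.
move=> x01; elim: k => [|k IH]; first by rewrite /=; lra.
rewrite S_INR -tech_pow_Rmult.
have k0 := pos_INR k.
have : (1 - x) * (1 - INR k * x) <= (1 - x) * (1 - x) ^ k.
  by apply: Rmult_le_compat_l => //; lra.
have : 0 <= INR k * x * x by apply: Rmult_le_pos; [apply: Rmult_le_pos|]; lra.
lra.
Qed.

Lemma exp_pow_nat (x : R) (k : nat) : exp x ^ k = exp (INR k * x).
Proof.
elim: k => [|k IH]; first by rewrite /= Rmult_0_l exp_0.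
by rewrite -tech_pow_Rmult IH S_INR -exp_plus; congr exp; ring.
Qed.

Lemma ln2_lt_1 : ln 2 < 1.
Proof.
have := exp_ineq1 1 ltac:(lra) => h.
by rewrite -[X in _ < X]ln_exp; apply: ln_increasing; lra.
Qed.

(** Since 1 - q <= exp(-q), the product is at most exp(t ln 2 - n q) <= exp(-t (1 - ln 2)). *)
Lemma pow_1m_lt_pow2 (q : R) (n t : nat) :
  (0 < t)%N -> q <= 1 -> INR t <= INR n * q -> (1 - q) ^ n * 2 ^ t < 1.
Proof.
move=> t0 q1 h.
have tR : 0 < INR t by apply: lt_0_INR; apply/ssrnat.ltP.
have e1 : (1 - q) ^ n <= exp (- (INR n * q)).
  rewrite Ropp_mult_distr_r -exp_pow_nat; apply: pow_incr; split; first lra.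
  by have := exp_ineq1_le (- q); lra.
have e2 : 2 ^ t = exp (INR t * ln 2) by rewrite -exp_pow_nat exp_ln; lra.
rewrite e2; apply: (Rle_lt_trans _ (exp (- (INR n * q)) * exp (INR t * ln 2))).
  by apply: Rmult_le_compat_r => //; left; apply: exp_pos.
rewrite -exp_plus -exp_0; apply: exp_increasing.
have : 0 < INR t * (1 - ln 2) by apply: Rmult_lt_0_compat => //; have := ln2_lt_1; lra.
lra.
Qed.

(** * The two criteria over the standard reals, in terms of u_i = 1 - p_i *)

Lemma choosable_of_weightsR (s : nat) (n : 'I_s.+1 -> nat) (u : 'I_s.+1 -> R) k :
  (forall i, u i <= 1) -> \big[Rplus/0]_i u i = INR s ->
  \big[Rplus/0]_i (INR (n i) * u i ^ k) < 1 ->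
  choosable (@Kadj s n) k.
Proof.
move=> u1 su /RltP lt1.
apply: (@choosable_of_weights R s n (fun i => 1 - u i)%R) => [i||].
- by rewrite subr_ge0; apply/RleP.
- rewrite big_split /= sumrN sumr_const card_ord.
  have -> : (\sum_i u i)%R = INR s by rewrite -su.
  by rewrite INRE -natrB // subSnn.
apply: le_lt_trans lt1; rewrite le_eqVlt; apply/orP; left; apply/eqP.
by apply: eq_bigr => i _; rewrite opprB addrC subrK INRE RpowE RmultE.
Qed.

(** The share q_i is (u_i - k/t)^k: a set of a <= (1 - u_i) t colors leaves t - a - k >= (u_i - k/t)
    t. *)
Lemma not_choosable_of_weightsR (s : nat) (n : 'I_s.+1 -> nat) (u : 'I_s.+1 -> R) t k :
  (0 < t)%N -> (k <= t)%N ->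
  (forall i, INR k / INR t <= u i <= 1) -> \big[Rplus/0]_i u i = INR s ->
  (forall i, INR t <= INR (n i) * (u i - INR k / INR t) ^ k) ->
  ~ choosable (@Kadj s n) k.
Proof.
move=> t0 kt u01 su Hn.
have tR : 0 < INR t by apply: lt_0_INR; apply/ssrnat.ltP.
have kR := pos_INR k.
have kt0 : 0 <= INR k / INR t by apply: Rdiv_le_0_compat.
apply: (@not_choosable_of_weights R s n (fun i => 1 - u i)%R
   (fun i => (u i - INR k / INR t) ^ k) t k) => //.
- rewrite big_split /= sumrN sumr_const card_ord.
  have -> : (\sum_i u i)%R = INR s by rewrite -su.
  by rewrite INRE -natrB // subSnn.
- move=> i; apply/RleP; rewrite -R1E -(pow1 k); apply: pow_incr.
  by have := u01 i; lra.
- move=> i a ha at'; rewrite RpowE; apply: binomial_ratio_ge.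
    by apply/RleP; rewrite -R0E; have := u01 i; lra.
  move: ha => /RleP; rewrite -!INRE => ha; apply/RleP.
  move: ha; rewrite -!RealsE => ha.
  have E : INR k / INR t * INR t = INR k by field; lra.
  rewrite -?R1E in ha; lra.
move=> i; apply/RltP; rewrite -!RealsE.
apply: pow_1m_lt_pow2 => //; rewrite -(pow1 k); apply: pow_incr.
by have := u01 i; lra.
Qed.

(** * Size of the weights and of the scale T, and choosability near T *)

Section Weights.
Variables (s : nat) (n : 'I_s.+1 -> nat) (T : R).
Let u i := exp (- (ln (INR (n i)) / T)).
Hypothesis s_ge1 : (1 <= s)%N.
Hypothesis T_gt0 : 0 < T.
Hypothesis n_homo : forall i j : 'I_s.+1, (i <= j)%N -> (n i <= n j)%N.
Hypothesis n0_gt0 : (0 < n ord0)%N.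
Hypothesis ln_n0 : 1 <= ln (INR (n ord0)).
Hypothesis weight_sum : \big[Rplus/0]_i u i = INR s.

Lemma part_gt0 i : 0 < INR (n i).
Proof. by apply/lt_0_INR/ssrnat.ltP; apply: leq_trans n0_gt0 _; apply: n_homo. Qed.

Lemma ln_part_homo (i j : 'I_s.+1) : (i <= j)%N -> ln (INR (n i)) <= ln (INR (n j)).
Proof. by move=> ij; apply: ln_le; [apply: part_gt0 | apply: le_INR; apply/ssrnat.leP/n_homo]. Qed.

Lemma weight_homo (i j : 'I_s.+1) : (i <= j)%N -> u j <= u i.
Proof.
move=> ij; apply: exp_nondecreasing; apply: Ropp_le_contravar.
apply: Rmult_le_compat_r; last exact: ln_part_homo.
by left; apply: Rinv_0_lt_compat.
Qed.

Lemma weight_le1 i : u i <= 1.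
Proof.
rewrite -exp_0; apply: exp_nondecreasing; rewrite -[X in _ <= X]Ropp_0; apply: Ropp_le_contravar.
apply: Rdiv_le_0_compat => //; have := ln_part_homo (leq0n i : (ord0 <= i)%N); lra.
Qed.

(** The least weight, that of the last part, is at most the average s/(s+1), and it is at least 1 -
    ln n_s / T. *)
Lemma scale_le : T <= INR s.+1 * ln (INR (n ord_max)).
Proof.
have h : INR s.+1 * u ord_max <= INR s.
  rewrite -weight_sum; apply/RleP; rewrite (INRE s.+1) RmultE mulr_natl -[X in (_ *+ X)%R]card_ord -sumr_const.
  by apply: ler_sum => i _; apply/RleP; apply: weight_homo; rewrite -ltnS.
have := exp_ineq1_le (- (ln (INR (n ord_max)) / T)); rewrite -/(u ord_max) => h2.
set M := ln _ in h2 *.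
have h3 : INR s.+1 * (1 + - (M / T)) <= INR s.
  by apply: Rle_trans h; apply: Rmult_le_compat_l => //; apply: pos_INR.
have -> : INR s.+1 * M = (INR s.+1 * (M / T)) * T by field; lra.
rewrite -[X in X <= _]Rmult_1_l; apply: Rmult_le_compat_r; first lra.
by move: h3; rewrite S_INR; lra.
Qed.

(** The probabilities 1 - u_i add up to 1, and the first and last parts differ, so u_s >= 1 - u_0.
    From ln n_0 >= 1 one gets u_0 <= exp(-1/T) <= T/(T+1). *)
Lemma weight_ge i : / (T + 1) <= u i.
Proof.
apply: Rle_trans (weight_homo (_ : (i <= ord_max)%N)); last by rewrite -ltnS.
have h : (1 - u ord0) + (1 - u ord_max) <= 1.
  have E : \big[Rplus/0]_i (1 - u i) = 1.
    rewrite big_split /= sumrN sumr_const card_ord.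
    have -> : (\sum_i u i)%R = INR s by rewrite -weight_sum.
    by rewrite INRE R1E RplusE -natrB // subSnn.
  rewrite -[X in _ <= X]E.
  have ge0 j : (0 <= 1 - u j)%R by rewrite subr_ge0; apply/RleP; apply: weight_le1.
  rewrite (bigD1 ord0) //= (bigD1 ord_max) //=; last first.
    by rewrite -val_eqE /= -lt0n.
  apply: Rplus_le_compat_l; rewrite -[X in X <= _]Rplus_0_r; apply: Rplus_le_compat_l.
  by apply/RleP; apply: sumr_ge0 => j _; apply: ge0.
have : u ord0 <= / (1 + / T).
  rewrite /u exp_Ropp; apply: Rinv_le_contravar.
    by have := Rinv_0_lt_compat _ T_gt0; lra.
  apply: Rle_trans (exp_ineq1_le _); apply: Rplus_le_compat_l.
  rewrite -[X in X <= _]Rmult_1_l; apply: Rmult_le_compat_r => //.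
  by left; apply: Rinv_0_lt_compat.
have -> : / (1 + / T) = 1 - / (T + 1) by field; lra.
lra.
Qed.

(** The lower bound on u_s reads exp(ln n_s / T) <= T + 1 <= exp T. It makes T tend to infinity with
    n_s. *)
Lemma ln_part_le_sqr : ln (INR (n ord_max)) <= T * T.
Proof.
have := weight_ge ord_max; rewrite /u exp_Ropp => /Rinv_le_contravar.
have T1 : 0 < T + 1 by lra.
rewrite !Rinv_inv => /(_ (Rinv_0_lt_compat _ T1)) h.
set M := ln _ in h *.
have h2 : M / T <= T.
  apply: Rnot_lt_le => /exp_increasing; have := exp_ineq1_le T; lra.
have -> : M = (M / T) * T by field; lra.
by apply: Rmult_le_compat_r; lra.
Qed.

(** Each of the s+1 terms n_i u_i^k is at most n_i^(-d) <= n_0^(-d). *)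
Lemma Kadj_choosable (d : R) (k : nat) :
  INR s.+1 < exp (d * ln (INR (n ord0))) -> 0 < d ->
  (1 + d) * T <= INR k -> choosable (@Kadj s n) k.
Proof.
move=> hs d0 hk; apply: (choosable_of_weightsR weight_le1 weight_sum).
have e i : INR (n i) * u i ^ k <= exp (- (d * ln (INR (n ord0)))).
  rewrite exp_pow_nat -{1}[INR (n i)]exp_ln; last exact: part_gt0.
  rewrite -exp_plus; apply: exp_nondecreasing.
  have l0 := ln_part_homo (leq0n i : (ord0 <= i)%N).
  set l := ln (INR (n i)) in l0 *; set m := ln (INR (n ord0)) in l0 *.
  have h : (1 + d) * l <= INR k * (l / T).
    have -> : INR k * (l / T) = INR k / T * l by field; lra.
    apply: Rmult_le_compat_r; first by rewrite /m in l0; lra.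
    by apply/Rle_div_r.
  nra.
have : \big[Rplus/0]_i (INR (n i) * u i ^ k)
       <= INR s.+1 * exp (- (d * ln (INR (n ord0)))).
  apply/RleP; rewrite (INRE s.+1) RmultE mulr_natl.
  rewrite -[X in (_ *+ X)%R]card_ord -sumr_const.
  by apply: ler_sum => i _; apply/RleP; apply: e.
rewrite exp_Ropp => h; apply: Rle_lt_trans h _.
have e0 := exp_pos (d * ln (INR (n ord0))).
by apply/Rlt_div_l; lra.
Qed.

(** The palette is so large that k (k/t) <= u_i / 2; by Bernoulli's inequality, passing from u_i to
    u_i - k/t then at most halves the k-th power. Since n_i u_i^k >= n_0^d >= 10 T^3, what remains
    is at least 5 T^3 >= t. *)
Lemma Kadj_not_choosable (d : R) (k : nat) :
  0 < d < 1 -> 1 <= T -> 10 * T ^ 3 <= exp (d * ln (INR (n ord0))) ->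
  INR k <= (1 - d) * T -> ~ choosable (@Kadj s n) k.
Proof.
move=> d01 T1 hT hk.
have kT : INR k <= T by nra.
have k0 := pos_INR k.
have [t' [t'le ltt']] := @floor_nat (2 * T ^ 2 * (T + 1)) ltac:(nra).
have [t Et] : exists t, t = t'.+1 by exists t'.+1.
have [tge tle] : 2 * T ^ 2 * (T + 1) <= INR t <= 5 * T ^ 3.
  rewrite Et S_INR; split; first lra; nra.
have kt : INR k <= INR t by nra.
have t0 : 0 < INR t by nra.
have r0 : 0 <= INR k / INR t by apply: Rdiv_le_0_compat.
have ku i : INR k * (INR k / INR t) <= / 2 * u i.
  apply: (Rle_trans _ (/ 2 * / (T + 1))); last by have := weight_ge i; lra.
  have -> : INR k * (INR k / INR t) = INR k * INR k * / INR t by field; lra.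
  apply: (Rle_trans _ (T * T * / (2 * T ^ 2 * (T + 1)))).
    apply: Rmult_le_compat; [nra | by left; apply: Rinv_0_lt_compat | nra |].
    by apply: Rinv_le_contravar; nra.
  by right; field; lra.
apply: (@not_choosable_of_weightsR s n u t k _ _ _ weight_sum).
- by rewrite Et.
- by apply/ssrnat.leP/INR_le.
- move=> i; split; last exact: weight_le1.
  have := ku i; have := exp_pos (- (ln (INR (n i)) / T)); rewrite -/(u i) => u0 h.
  (* The bound on k (k/t) says nothing about k/t when k = 0, but then k/t is 0. *)
  case: (k) (h) r0 => [|k'] h' r0; first by rewrite /= /Rdiv Rmult_0_l; lra.
  move: h'; rewrite {1}S_INR; have := pos_INR k'; nra.
move=> i.
have u0 : 0 < u i by apply: exp_pos.
set r := INR k / INR t in r0 ku *.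
have Er : u i - r = u i * (1 - r / u i) by field; lra.
have ru : INR k * (r / u i) <= / 2.
  have -> : INR k * (r / u i) = INR k * r / u i by field; lra.
  by apply/Rle_div_l => //; apply: ku.
have ru0 : 0 <= r / u i by apply: Rdiv_le_0_compat.
have half : / 2 <= (1 - r / u i) ^ k.
  case: (posnP k) => [->|kp]; first by rewrite /=; lra.
  have k1 : 1 <= INR k by apply: (le_INR 1); apply/ssrnat.leP.
  apply: Rle_trans (bernoulli_le (x := r / u i) k _); first lra.
  by split=> //; nra.
rewrite Er Rpow_mult_distr -Rmult_assoc.
have big : 10 * T ^ 3 <= INR (n i) * u i ^ k.
  apply: (Rle_trans _ _ _ hT).
  rewrite exp_pow_nat -{1}[INR (n i)]exp_ln; last exact: part_gt0.
  rewrite -exp_plus; apply: exp_nondecreasing.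
  have l0 := ln_part_homo (leq0n i : (ord0 <= i)%N).
  set l := ln (INR (n i)) in l0 *; set m := ln (INR (n ord0)) in l0 *.
  have h : INR k * (l / T) <= (1 - d) * l.
    have -> : INR k * (l / T) = INR k / T * l by field; lra.
    apply: Rmult_le_compat_r; first by rewrite /m in l0; lra.
    by apply/Rle_div_l.
  nra.
apply: (Rle_trans _ (10 * T ^ 3 * / 2)); first lra.
by apply: Rmult_le_compat => //; nra.
Qed.
End Weights.

(** * The choice number as a minimum, and its bounds *)

Section ChoiceNumber.
Variables (V : finType) (adj : rel V).

Lemma choosable_mono (k k' : nat) : (k <= k')%N -> choosable adj k -> choosable adj k'.
Proof. by move=> kk' ch_k S HS; apply: ch_k => v; apply: leq_trans kk' (HS v). Qed.

Lemma choosablebP k : reflect (choosable adj k) (choosableb adj k).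
Proof.
rewrite /choosableb.
by case: (excluded_middle_informative _) => h; constructor.
Qed.

Lemma ch_spec k : choosable adj k -> choosable adj (ch adj) /\ (ch adj <= k)%N.
Proof.
move=> hk; rewrite /ch; case: (excluded_middle_informative _) => [h|[]].
  by case: ex_minnP => c /choosablebP hc min; split=> //; apply/min/choosablebP.
by exists k; apply/choosablebP.
Qed.
End ChoiceNumber.

Lemma chK_bounds (s : nat) (n : 'I_s.+1 -> nat) (T d : R) :
  (1 <= s)%N -> (forall i j : 'I_s.+1, (i <= j)%N -> (n i <= n j)%N) ->
  (0 < n ord0)%N -> 1 <= ln (INR (n ord0)) ->
  \big[Rplus/0]_i exp (- (ln (INR (n i)) / T)) = INR s ->
  0 < d < 1 -> / d <= T ->
  INR s.+1 < exp (d * ln (INR (n ord0))) ->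
  10 * T ^ 3 <= exp (d * ln (INR (n ord0))) ->
  (1 - d) * T < INR (chK n) <= (1 + 2 * d) * T.
Proof.
move=> s1 n_homo n0 ln0 su d01 dT h1 h2.
have T1 : 1 < T by have := Rinv_lt_contravar d 1 ltac:(lra) ltac:(lra); rewrite Rinv_1; lra.
have T0 : 0 < T by lra.
have dT1 : 1 <= d * T.
  have -> : 1 = d * / d by field; lra.
  by apply: Rmult_le_compat_l; lra.
(* Rounding down loses less than 1 <= d T, so k is still at least (1 + d) T. *)
have [k [kle ltk]] := @floor_nat ((1 + 2 * d) * T) ltac:(nra).
have hk : choosable (@Kadj s n) k.
  by apply: (Kadj_choosable T0 n_homo n0 ln0 su h1 (proj1 d01)); lra.
have [hc /ssrnat.leP/le_INR ck] := ch_spec hk.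
split; last by rewrite /chK; lra.
apply: Rnot_le_lt => le.
by apply: (Kadj_not_choosable s1 T0 n_homo n0 ln0 su d01 _ h2 le hc); lra.
Qed.

(** * The root x_0, the growth of n_0, and the limit *)

(** As 1/k_j = ln n_j / ln n_s, the power of x with exponent (k_j - 1)/k_j is x n_j^(-1/T); the last
    weight is 1/x and accounts for the term -1. *)
Lemma root_weights (s : nat) (n : 'I_s.+1 -> nat) (x : R) :
  (forall i, (2 <= n i)%N) -> 1 <= x ->
  INR s * x - 1 - \big[Rplus/0]_(j < s)
    (let kj := log2 (INR (n ord_max)) / log2 (INR (n (widen_ord (leqnSn s) j))) in
     Rpower x ((kj - 1) / kj)) = 0 ->
  1 < x /\
  \big[Rplus/0]_i exp (- (ln (INR (n i)) / (log2 (INR (n ord_max)) / log2 x))) = INR s.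
Proof.
move=> n2 x1; cbv zeta => E.
have lnn i : 0 < ln (INR (n i)).
  rewrite -ln_1; apply: ln_increasing; first lra.
  by apply: (lt_INR 1); apply/ssrnat.ltP.
have ln20 : 0 < ln 2 by have := ln_lt_2; lra.
have xgt1 : 1 < x.
  (* At x = 1 all powers are 1 and the equation would read -1 = 0. *)
  case: x1 => // x1; exfalso; move: E; rewrite -x1.
  under eq_bigr do rewrite /Rpower ln_1 Rmult_0_r exp_0.
  have -> : \big[Rplus/0]_(j < s) 1 = INR s.
    by rewrite INRE big_const_ord iter_addr_0.
  lra.
split=> //.
have lx : 0 < ln x by rewrite -ln_1; apply: ln_increasing; lra.
set T := log2 (INR (n ord_max)) / log2 x.
have ET : T = ln (INR (n ord_max)) / ln x.
  by rewrite /T /log2; field; lra.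
rewrite big_ord_recr /=.
have Emax : exp (- (ln (INR (n ord_max)) / T)) = / x.
  rewrite -[in RHS](exp_ln x); last lra.
  rewrite -exp_Ropp ET; congr (exp (- _)); field.
  by have := lnn ord_max; lra.
rewrite Emax.
set Sg := \big[Rplus/0]_(j < s) exp _.
have ES : \big[Rplus/0]_(j < s) Rpower x
    ((log2 (INR (n ord_max)) / log2 (INR (n (widen_ord (leqnSn s) j))) - 1) /
     (log2 (INR (n ord_max)) / log2 (INR (n (widen_ord (leqnSn s) j))))) = x * Sg.
  rewrite /Sg big_distrr /=; apply: eq_bigr => j _.
  rewrite -{2}(exp_ln x); last lra.
  rewrite /Rpower -exp_plus ET /log2; congr exp; field.
  by have := lnn ord_max; have := lnn (widen_ord (leqnSn s) j); lra.
rewrite ES in E.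
have -> : Sg = INR s - / x.
  apply: (Rmult_eq_reg_l x); last lra.
  have -> : x * (INR s - / x) = INR s * x - 1 by field; lra.
  lra.
by rewrite /=; lra.
Qed.

(** The exponent eventually exceeds any constant A, so n_0 >= (ln n_s)^A: with L = log n_s, log L <=
    4 sqrt L gives L / log L >= sqrt L / 4 >= A^2. *)
Lemma ln_part0_ge (A N a n0 : R) :
  0 < A -> 16 * A ^ 4 + 3 <= ln N -> n0 = Rpower (log2 N) a ->
  a >= 2 * sqrt (log2 N / log2 (log2 N)) ->
  A * ln (ln N) <= ln n0.
Proof.
move=> A0 hN -> ha.
set L := log2 N in ha *.
have A4 : 0 < A ^ 4 by apply: pow_lt.
have l2 := ln_lt_2; have l2' := ln2_lt_1.
have LN : ln N <= L.
  rewrite /L /log2; apply/Rle_div_r; first lra.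
  rewrite -[X in _ <= X]Rmult_1_r; apply: Rmult_le_compat_l; lra.
have lnlnN : 0 < ln (ln N) by rewrite -ln_1; apply: ln_increasing; lra.
have lnL : ln (ln N) <= ln L by apply: ln_le; lra.
set r := sqrt L.
have r0 : 0 < r by apply: sqrt_lt_R0; lra.
have rr : r * r = L by apply: sqrt_sqrt; lra.
have lnr : ln r <= r.
  by rewrite -[X in _ <= X]ln_exp; apply: ln_le => //; have := exp_ineq1_le r; lra.
have lnLr : ln L <= 2 * r by rewrite -rr ln_mult //; lra.
have logL : log2 L <= 4 * r.
  rewrite /log2; apply/Rle_div_l; [lra | nra].
have logL0 : 0 < log2 L by apply: Rdiv_lt_0_compat; lra.
have rA : 4 * A ^ 2 <= r.
  apply: Rnot_lt_le => lt.
  have : r * r < (4 * A ^ 2) * (4 * A ^ 2) by apply: Rmult_le_0_lt_compat; lra.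
  have -> : (4 * A ^ 2) * (4 * A ^ 2) = 16 * A ^ 4 by ring.
  lra.
have aA : A <= a.
  have : A <= sqrt (L / log2 L).
    rewrite -[A]sqrt_Rsqr; last lra.
    apply: sqrt_le_1_alt; rewrite /Rsqr; apply/(Rle_div_r (A * A) _ _ logL0).
    have A2 : 0 < A ^ 2 by apply: pow_lt.
    have : A * A * log2 L <= A * A * (4 * r) by apply: Rmult_le_compat_l; nra.
    have : r * (4 * A ^ 2) <= r * r by apply: Rmult_le_compat_l; lra.
    lra.
  have := sqrt_pos (L / log2 L); lra.
by rewrite /Rpower ln_exp; apply: Rmult_le_compat; lra.
Qed.

(* [%R] has come to mean the ring scope of MathComp. *)
Delimit Scope R_scope with R.

(* n m : 'I_s.+1 -> nat is the m-th tuple (n_0,...,n_s); n m ord_max = n_s.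
   x0 m is the root in [1,oo) of  s x - 1 - sum_{j<s} x^{(k_j-1)/k_j} = 0,
   k_j = log n_s / log n_j.  The conclusion ch = (1+o(1)) log n_s / log x0
   is stated as: the ratio ch / (log n_s / log x0) tends to 1. *)
Theorem theorem4 (s : nat) (hs : (1 <= s)%N)
  (n : nat -> 'I_s.+1 -> nat) (x0 : nat -> R)
  (Hmono : forall m (i j : 'I_s.+1), (i <= j)%N -> (n m i <= n m j)%N)
  (H2 : forall m, (2 <= n m ord0)%N)
  (Hinf : forall B : nat, exists M : nat, forall m, (M <= m)%N -> (B <= n m ord_max)%N)
  (Halpha : forall m, exists alpha : R,
      INR (n m ord0) = Rpower (log2 (INR (n m ord_max))) alpha /\
      (alpha >= 2 * sqrt (log2 (INR (n m ord_max)) / log2 (log2 (INR (n m ord_max)))))%R)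
  (Hx0 : forall m,
      (1 <= x0 m)%R /\
      (INR s * x0 m - 1
       - \big[Rplus/0%R]_(j < s)
           (let kj := (log2 (INR (n m ord_max)) / log2 (INR (n m (widen_ord (leqnSn s) j))))%R in
            Rpower (x0 m) ((kj - 1) / kj)) = 0)%R) :
  Un_cv (fun m => (INR (chK (n m)) / (log2 (INR (n m ord_max)) / log2 (x0 m)))%R) 1%R.
Proof.
move=> eps eps0.
(* The final error is at most 2 d < eps. *)
pose d := Rmin (/ 2) (eps / 3).
have d0 : 0 < d by apply: Rmin_pos; lra.
have d2 : d <= / 2 by apply: Rmin_l.
have deps : d <= eps / 3 by apply: Rmin_r.
(* This makes n_0^d at least M^4 for M = ln n_s: three factors M pay for T^3 <= ((s+1) M)^3, the
   fourth for the constant 10 (s+1)^3. *)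
pose A := 4 / d.
have A0 : 0 < A by apply: Rdiv_lt_0_compat; lra.
have dA : d * A = 4 by rewrite /A; field; lra.
(* A threshold for ln n_s: the first two terms serve [ln_part0_ge], the third absorbs the constant
   in [h2], and the last yields T >= 1/d through ln n_s <= T^2. *)
pose K := 16 * A ^ 4 + 3 + 10 * INR s.+1 ^ 3 + / d * / d.
have A4 : 0 < A ^ 4 by apply: pow_lt.
have s1 : 1 <= INR s.+1 by apply: (le_INR 1); apply/ssrnat.leP.
have s3 : INR s.+1 <= INR s.+1 ^ 3 by rewrite -[X in X <= _]pow_1; apply: Rle_pow => //; apply/ssrnat.leP.
have id0 : 0 < / d by apply: Rinv_0_lt_compat.
have id2 : 0 < / d * / d by apply: Rmult_lt_0_compat.
have [B [_ KB]] := @floor_nat (exp K) (Rlt_le _ _ (exp_pos K)).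
have [M0 HM0] := Hinf B.+1.
exists M0 => m /ssrnat.leP/HM0 /ssrnat.leP/le_INR; rewrite S_INR => Bn.
have n2 i : (2 <= n m i)%N by apply: leq_trans (H2 m) (Hmono m ord0 i (leq0n i)).
have [x1 /(root_weights n2 x1) [xgt1 su]] := Hx0 m.
have [a [na ha]] := Halpha m.
set N := INR (n m ord_max) in Bn na ha su *.
set T := log2 N / log2 (x0 m) in su *.
set M := ln N.
have KM : K <= M by rewrite -[K]ln_exp; apply: ln_le; [apply: exp_pos | lra].
have T0 : 0 < T.
  have p y : 1 < y -> 0 < log2 y.
    move=> y1; apply: Rdiv_lt_0_compat; last by have := ln_lt_2; lra.
    by rewrite -ln_1; apply: ln_increasing; lra.
  apply: Rdiv_lt_0_compat; apply: p => //.
  by apply: (lt_INR 1); apply/ssrnat.ltP.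
have lM : 1 <= ln M.
  rewrite -[X in X <= _]ln_exp; apply: ln_le; first exact: exp_pos.
  by have := exp_le_3; rewrite /K in KM; lra.
have ln0 : A * ln M <= ln (INR (n m ord0)).
  by apply: (ln_part0_ge A0 _ na ha); rewrite -/M /K in KM *; lra.
have ln01 : 1 <= ln (INR (n m ord0)) by nra.
have n0 : (0 < n m ord0)%N by apply: leq_trans (H2 m).
have hT1 : T <= INR s.+1 * M := scale_le T0 (Hmono m) n0 su.
have hT2 : M <= T * T := ln_part_le_sqr hs T0 (Hmono m) n0 ln01 su.
have idT : / d <= T.
  apply: Rnot_lt_le => lt.
  have : T * T < / d * / d by apply: Rmult_le_0_lt_compat; lra.
  by rewrite /K in KM; lra.
have M0' : 1 < M by rewrite /K in KM; lra.
have e4 : M ^ 4 <= exp (d * ln (INR (n m ord0))).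
  have -> : M ^ 4 = exp (4 * ln M).
    by rewrite -[X in X ^ 4](exp_ln M) ?exp_pow_nat; [congr exp; rewrite /=; lra | lra].
  apply: exp_nondecreasing; rewrite -dA Rmult_assoc; apply: Rmult_le_compat_l; lra.
have sM : 10 * INR s.+1 ^ 3 <= M by rewrite /K in KM; lra.
have M3 : 1 <= M ^ 3 by apply: pow_R1_Rle; lra.
have M4 : M * M ^ 3 = M ^ 4 by [].
have h1 : INR s.+1 < exp (d * ln (INR (n m ord0))) by nra.
have h2 : 10 * T ^ 3 <= exp (d * ln (INR (n m ord0))).
  apply: Rle_trans e4; rewrite -M4.
  apply: (Rle_trans _ (10 * (INR s.+1 * M) ^ 3)).
    by apply: Rmult_le_compat_l; [lra | apply: pow_incr; lra].
  have -> : 10 * (INR s.+1 * M) ^ 3 = 10 * INR s.+1 ^ 3 * M ^ 3 by ring.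
  apply: Rmult_le_compat_r; lra.
have d01 : 0 < d < 1 by lra.
have [lo hi] := chK_bounds hs (Hmono m) n0 ln01 su d01 idT h1 h2.
rewrite /R_dist; apply: Rabs_def1.
  suff : INR (chK (n m)) / T <= 1 + 2 * d by lra.
  exact/Rle_div_l.
suff : 1 - d < INR (chK (n m)) / T by lra.
exact/Rlt_div_r.
Qed.
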